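(* Let $V$ be a vector space over a field, let $W$ be a subspace of $V$, let $\mathbb{S}(W)$ be a subsemigroup of $L(W)$ such that $I_W\in\mathbb{S}(W)$, and let $f\in L_{\mathbb{S}(W)}(V)$. Then $f$ is a unit-regular element of $L_{\mathbb{S}(W)}(V)$ if and only if all of the following hold: (i) $f_{\upharpoonright_W}$ is a unit-regular element of $\mathbb{S}(W)$; (ii) $R(f)\cap W=R(f_{\upharpoonright_W})$; (iii) $\mathrm{codim}(W+T_f)=\mathrm{codim}(W+R(f))$ for some subspace $T_f$ of $V$ such that $T_f$ and $W\cap T_f$ are transversals of $\ker(f)$ and $\ker(f_{\upharpoonright_W})$, respectively.
   Context: For a vector space $U$, $L(U)$ is the semigroup of all linear maps $U\to U$ under composition (composed from left to right, with $vf$ denoting the image of $v$ under $f$), and $I_U$ is the identity map on $U$. For $f\in L(V)$ with $Wf\subseteq W$, $f_{\upharpoonright_W}\in L(W)$ denotes the linear map $W\to W$ that agrees with $f$ on $W$. Define $L_{\mathbb{S}(W)}(V)=\{f\in L(V) : Wf\subseteq W \text{ and } f_{\upharpoonright_W}\in\mathbb{S}(W)\}$, a subsemigroup of $L(V)$; it contains $I_V$ when $I_W\in\mathbb{S}(W)$. For a map $h\colon A\to A$, $R(h)$ is its image and $\ker(h)=\{(x,y)\in A\times A : xh=yh\}$ is its kernel as an equivalence relation on $A$ (not the null space). A transversal of an equivalence relation on $A$ is a subset of $A$ containing exactly one element of each class. For a subspace $U$ of $V$, $\mathrm{codim}(U)=\dim(V/U)$ (a possibly infinite cardinal). In a semigroup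 $S$ with identity, $U(S)$ is the set of units of $S$, and $a\in S$ is unit-regular if there is $u\in U(S)$ with $aua=a$. *)

(* Defs.v *)
From HB Require Import structures.
From mathcomp Require Import all_boot all_order all_algebra.
From mathcomp Require Import boolp classical_sets functions cardinality.

Set Implicit Arguments.
Unset Strict Implicit.
Unset Printing Implicit Defensive.

Import GRing.Theory.

Local Open Scope quotient_scope.
Local Open Scope ring_scope.
Local Open Scope classical_set_scope.
Local Open Scope card_scope.

Section UnitRegular.
Local Open Scope group_scope.
Variables (M : monoidType) (S : {pred M}).

(* [S] stands for a subsemigroup of [M] that contains the identity of [M],
   which is then the identity of [S]; the inverse must itself lie in [S]. *)
Definition is_unit_of (u : M) : Prop :=
  u \in S /\ exists2 v : M, v \in S & u * v = 1 /\ v * u = 1.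

Definition unit_regular (a : M) : Prop :=
  a \in S /\ exists2 u : M, is_unit_of u & a * u * a = a.

End UnitRegular.

Section LinearMaps.
Variables (K : fieldType) (U : lmodType K).

Definition L : Type := {linear U -> U}.

HB.instance Definition _ := gen_eqMixin L.
HB.instance Definition _ := gen_choiceMixin L.

Lemma L_eq (f g : L) : f =1 g -> f = g.
Proof.
case: f g => [f [[f1] [f2]]] [g [[g1] [g2]]] /= /funext E.
move: f1 f2; rewrite {}E => f1 f2.
by rewrite (Prop_irrelevance f1 g1) (Prop_irrelevance f2 g2).
Qed.

(* Maps act on the right, so the product [f * g] is "first f, then g". *)
Definition L_mul (f g : L) : L := g \o f.
Definition L_one : L := idfun.

Lemma L_mulA : associative L_mul.
Proof. by move=> f g h; apply: L_eq. Qed.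
Lemma L_1mul : left_id L_one L_mul.
Proof. by move=> f; apply: L_eq. Qed.
Lemma L_mul1 : right_id L_one L_mul.
Proof. by move=> f; apply: L_eq. Qed.

HB.instance Definition _ := isMonoid.Build L L_mulA L_1mul L_mul1.

(* The kernel of a map as an equivalence relation, not its null space. *)
Definition kernel_rel (f : L) : set (U * U) := [set p | f p.1 = f p.2].

End LinearMaps.

(* Exactly one element of [T] in the class of each [x]. *)
Definition transversal_of (A : Type) (E : set (A * A)) (T : set A) : Prop :=
  forall x, exists! t, T t /\ E (x, t).

Section Subspaces.
Variables (K : fieldType) (V : lmodType K).
Implicit Types U W : submodClosed V.

(* Boolean membership is no restriction: any subspace has one, by [asbool]. *)
Definition subsp W : Type := {x : V | x \in W}.
HB.instance Definition _ W := SubChoice.on (subsp W).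
HB.instance Definition _ W :=
  GRing.SubChoice_isSubLmodule.Build K V (mem W) (subsp W)
    (GRing.subsemimodClosedP W).

(* The library has no inheritance from [submodClosed] to [zmodClosed]. *)
Definition submod_pred U : {pred V} := [in U].

Lemma submod_pred_closed U : submod_closed (submod_pred U).
Proof. exact: GRing.submodClosedP. Qed.

HB.instance Definition _ U :=
  GRing.isSubmodClosed.Build K V (submod_pred U) (submod_pred_closed U).

(* The additive quotsp is the library's; only the scaling is added. *)
Definition quotsp U : Type := Quotient.quot (submod_pred U).
HB.instance Definition _ U := GRing.Zmodule.on (quotsp U).
HB.instance Definition _ U := EqQuotient.on (quotsp U).

Section Quotient.
Variable U : submodClosed V.

Definition quotsp_scale (a : K) (x : quotsp U) : quotsp U :=
  \pi_(quotsp U) (a *: repr x).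

Lemma pi_eqP (x y : V) :
  reflect (\pi_(quotsp U) x = \pi_(quotsp U) y) (x - y \in U).
Proof. by rewrite (Quotient.idealrBE (submod_pred U)); apply: eqP. Qed.

Lemma pi_scale a x :
  quotsp_scale a (\pi_(quotsp U) x) = \pi_(quotsp U) (a *: x).
Proof.
apply/pi_eqP; rewrite -scalerBr; apply: rpredZ; apply/pi_eqP.
by rewrite reprK.
Qed.

Lemma quotsp_scaleA a b x :
  quotsp_scale a (quotsp_scale b x) = quotsp_scale (a * b) x.
Proof. by elim/quotW: x => x; rewrite (pi_scale b) !pi_scale scalerA. Qed.
Lemma quotsp_scale1 : left_id 1 quotsp_scale.
Proof. by move=> x; rewrite -[x]reprK pi_scale scale1r. Qed.
Lemma quotsp_scaleDr : right_distributive quotsp_scale +%R.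
Proof.
move=> a x y; rewrite -[x]reprK -[y]reprK !pi_scale.
by rewrite -!(@raddfD _ (Quotient.quot _)) /= pi_scale scalerDr.
Qed.
Lemma quotsp_scaleDl x : {morph quotsp_scale^~ x : a b / a + b}.
Proof.
move=> a b; rewrite -[x]reprK !pi_scale.
by rewrite -(@raddfD _ (Quotient.quot _)) /= scalerDl.
Qed.

HB.instance Definition _ :=
  GRing.Zmodule_isLmodule.Build K (quotsp U)
    quotsp_scaleA quotsp_scale1 quotsp_scaleDr quotsp_scaleDl.

End Quotient.

Section Sum.
Variables U W : submodClosed V.

Definition sum_pred : {pred V} :=
  [pred v | `[< exists u w, [/\ u \in U, w \in W & v = u + w] >]].

Lemma sum_pred_closed : submod_closed sum_pred.
Proof.
split=> [|a x y].
  by apply/asboolP; exists 0, 0; rewrite !rpred0 addr0.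
move=> /asboolP[u1 [w1 [u1U w1W ->]]] /asboolP[u2 [w2 [u2U w2W ->]]].
apply/asboolP; exists (a *: u1 + u2), (a *: w1 + w2).
by rewrite !rpredD ?rpredZ// scalerDr addrACA.
Qed.

HB.instance Definition _ := GRing.isSubmodClosed.Build K V sum_pred sum_pred_closed.

Definition sumsp : submodClosed V := sum_pred.

End Sum.

Section Image.
Variable f : L V.

Definition range_pred : {pred V} := [pred v | `[< range f v >]].

Lemma range_pred_closed : submod_closed range_pred.
Proof.
split=> [|a x y].
  by apply/asboolP; exists 0 => //; rewrite linear0.
move=> /asboolP[u _ <-] /asboolP[v _ <-].
by apply/asboolP; exists (a *: u + v) => //; rewrite linearP.
Qed.

HB.instance Definition _ :=
  GRing.isSubmodClosed.Build K V range_pred range_pred_closed.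

Definition rangesp : submodClosed V := range_pred.

End Image.

Section Restriction.
Variable W : submodClosed V.

Definition stable (f : L V) : Prop := {in W, forall v, f v \in W}.

Section Restr.
Variables (f : L V) (fW : stable f).

Definition restr_fun (w : subsp W) : subsp W :=
  exist _ (f (val w)) (fW (valP w)).

Lemma restr_linear : linear restr_fun.
Proof. by move=> a x y; apply: val_inj; rewrite /= linearP. Qed.

HB.instance Definition _ :=
  GRing.isLinear.Build K (subsp W) (subsp W) *:%R restr_fun restr_linear.

Definition restr : L (subsp W) := restr_fun.

End Restr.

Variable S : mulgClosed (L (subsp W)).

Definition L_S : {pred L V} :=
  [pred f | `[< exists fW : stable f, restr fW \in S >]].

Lemma L_S_stable (f : L V) : f \in L_S -> stable f.
Proof. by case/asboolP. Qed.

Lemma L_S_mul_closed : mulg_closed L_S.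
Proof.
move=> f g /asboolP[fW fS] /asboolP[gW gS]; apply/asboolP.
have fgW : stable (f * g)%g by move=> v /fW /gW.
exists fgW; suff -> : restr fgW = (restr fW * restr gW)%g by exact: gpredM.
by apply: L_eq => w; apply: val_inj.
Qed.

HB.instance Definition _ := isMulClosed.Build (L V) L_S L_S_mul_closed.

Lemma L_S_one : 1%g \in S -> 1%g \in L_S.
Proof.
move=> S1; apply/asboolP.
have W1 : stable 1%g by move=> v.
exists W1; suff -> : restr W1 = 1%g by [].
by apply: L_eq => w; apply: val_inj.
Qed.

End Restriction.

End Subspaces.

Section Dimension.
Variable K : fieldType.

Section Basis.
Variable E : lmodType K.

Definition lin_indep (B : set E) : Prop :=
  forall (s : seq E) (c : E -> K), uniq s -> [set` s] `<=` B ->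
    \sum_(v <- s) c v *: v = 0 -> {in s, forall v, c v = 0}.

Definition spanning (B : set E) : Prop :=
  forall x : E, exists (s : seq E) (c : E -> K),
    [set` s] `<=` B /\ x = \sum_(v <- s) c v *: v.

Definition basis (B : set E) : Prop := lin_indep B /\ spanning B.

End Basis.

(* [dim E = dim F] as cardinals, the dimension being the cardinal, possibly
   infinite, of any (Hamel) basis. *)
Definition eq_dim (E F : lmodType K) : Prop :=
  exists (A : set E) (B : set F), [/\ basis A, basis B & A #= B].

Definition eq_codim (V : lmodType K) (U W : submodClosed V) : Prop :=
  eq_dim (quotsp U) (quotsp W).

End Dimension.

(* Main.v *)
(* If [u] is a unit with [f u f = f], then [T = R(f u)] is a transversal of
   [ker f], and [u] carries [W + R(f)] onto [W + T]. Conversely, let [u0] be a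
   unit of [S(W)] with [f|W u0 f|W = f|W], and let [T1] be a complement in [T]
   of the intersection of [W] and [T]. Then [W + T] is the direct sum of [W] and
   [T1], and by (ii) [W + R(f)] is the direct sum of [W] and [T1 f]. The map
   equal to [u0] on [W] and to the inverse of [f] on [T1 f] is thus an
   isomorphism from [W + R(f)] onto [W + T], which by (iii) extends to an
   automorphism of [V]; this is the required unit. *)

Require Import Defs.
From HB Require Import structures.
From mathcomp Require Import all_boot all_order all_algebra.
From mathcomp Require Import boolp classical_sets functions cardinality.

Set Implicit Arguments.
Unset Strict Implicit.
Unset Printing Implicit Defensive.

Local Open Scope ring_scope.
Local Open Scope classical_set_scope.

Import GRing.Theory.

(** * Constructing linear maps; Hamel bases and equality of dimensions *)

Section LinearExtension.
Variable K : fieldType.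
Implicit Types E F Z : lmodType K.

(** Two values related to the same vector differ by a value related to 0, so [G] is single-valued
    and any choice function for it is linear. *)
Lemma linear_graph E F (G : E -> F -> Prop) :
    (forall x, exists y, G x y) ->
    (forall a x y x' y', G x y -> G x' y' -> G (a *: x + x') (a *: y + y')) ->
    (forall y, G 0 y -> y = 0) ->
  exists h : {linear E -> F}, forall x, G x (h x).
Proof.
move=> Gtot Glin G0; have [h Gh] := choice Gtot.
have Gfun x y y' : G x y -> G x y' -> y = y'.
  move=> Gy Gy'; apply/esym/eqP; rewrite -subr_eq0 addrC -scaleN1r; apply/eqP/G0.
  by have := Glin (-1) _ _ _ _ Gy Gy'; rewrite (scaleN1r x) addNr.
have hlin : linear h.
  by move=> a x y; apply: (Gfun _ _ _ (Gh _)); apply: Glin.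
pose hL : {linear E -> F} :=
  HB.pack h (GRing.isLinear.Build K E F *:%R h hlin).
by exists hL.
Qed.

(** The pairs [(p z, q z)] form a linear graph, single-valued because [q] vanishes wherever [p]
    does. *)
Lemma linear_factor Z E F (p : {linear Z -> E}) (q : {linear Z -> F}) :
    (forall x, exists z, p z = x) -> (forall z, p z = 0 -> q z = 0) ->
  exists h : {linear E -> F}, forall z, h (p z) = q z.
Proof.
move=> psurj pq0.
have [| | |h hP] := @linear_graph E F (fun x y => exists z, p z = x /\ q z = y).
- by move=> x; have [z <-] := psurj x; exists (q z), z.
- move=> a x y x' y' [z [<- <-]] [z' [<- <-]].
  by exists (a *: z + z'); rewrite !linearP.
- by move=> y [z [/pq0 qz0 <-]].
exists h => z; have [z' [pz' <-]] := hP (p z).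
by apply/eqP; rewrite -subr_eq0 -linearB pq0// linearB pz' subrr.
Qed.

(** A list of coefficient-vector pairs may repeat a vector, whereas [lin_indep] speaks of
    duplicate-free sequences; collecting the coefficients of each vector bridges the two. *)
Lemma lin_indep_list E F (B : set E) (g : E -> F) (l : seq (K * E)) :
    lin_indep B -> (forall p, p \in l -> B p.2) ->
    \sum_(p <- l) p.1 *: p.2 = 0 -> \sum_(p <- l) p.1 *: g p.2 = 0.
Proof.
move=> Bfree lB l0; pose s := undup [seq p.2 | p <- l].
pose c v := \sum_(p <- l | p.2 == v) p.1.
have regroup (M : lmodType K) (h : E -> M) :
    \sum_(p <- l) p.1 *: h p.2 = \sum_(v <- s) c v *: h v.
  under [RHS]eq_bigr do rewrite /c scaler_suml.
  rewrite (exchange_big_dep xpredT)//= big_seq [RHS]big_seq.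
  apply: eq_bigr => p pl; have ps : p.2 \in s by rewrite mem_undup map_f.
  rewrite -big_filter (@eq_filter _ _ (pred1 p.2)) => [|v]; last exact: eq_sym.
  by rewrite filter_pred1_uniq ?undup_uniq// big_seq1.
rewrite regroup big_seq big1// => v vs; rewrite (Bfree s c) ?scale0r ?undup_uniq//.
  by move=> w /=; rewrite mem_undup => /mapP[p pl ->]; exact: lB.
by rewrite -(regroup _ idfun).
Qed.

(** The graph of the extension consists of all combinations of basis vectors paired with the same
    combinations of their images; independence makes it single-valued. *)
Lemma linear_extension E F (B : set E) (g : E -> F) : basis B ->
  exists h : {linear E -> F}, forall b, B b -> h b = g b.
Proof.
move=> [Bfree Bspan].
pose G (x : E) (y : F) := exists l : seq (K * E),
  [/\ forall p, p \in l -> B p.2, x = \sum_(p <- l) p.1 *: p.2 &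
      y = \sum_(p <- l) p.1 *: g p.2].
have Guniq y : G 0 y -> y = 0.
  by move=> [l [lB /esym l0 ->]]; exact: lin_indep_list Bfree lB l0.
have Glin a x y x' y' : G x y -> G x' y' -> G (a *: x + x') (a *: y + y').
  move=> [l [lB -> ->]] [l' [l'B -> ->]].
  exists ([seq (a * p.1, p.2) | p <- l] ++ l'); split.
  - by move=> p; rewrite mem_cat => /orP[/mapP[r /lB rB ->]|/l'B].
  - rewrite big_cat big_map scaler_sumr; congr (_ + _).
    by apply: eq_bigr => p _; rewrite scalerA.
  - rewrite big_cat big_map scaler_sumr; congr (_ + _).
    by apply: eq_bigr => p _; rewrite scalerA.
have [x|h hG] := linear_graph _ Glin Guniq.
  have [s [c [sB ->]]] := Bspan x.
  exists (\sum_(v <- s) c v *: g v), [seq (c v, v) | v <- s].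
  by split=> [p /mapP[v /sB vB ->]||]; rewrite ?big_map.
exists h => b Bb; apply/eqP; rewrite -subr_eq0; apply/eqP/Guniq.
(* Subtracting the pair [(b, g b)] of the graph from [(b, h b)] gives a pair over 0. *)
rewrite -(subrr b) addrC -scaleN1r [in X in G _ X]addrC -(scaleN1r (g b)).
apply: Glin (hG b); exists [:: (1, b)].
by split=> [p|//=|//=]; rewrite ?inE ?big_seq1 ?scale1r// => /eqP->.
Qed.

Lemma eq_on_spanning E F (B : set E) (h h' : {linear E -> F}) : spanning B ->
  (forall b, B b -> h b = h' b) -> h =1 h'.
Proof.
move=> Bspan hh' x; have [s [c [sB ->]]] := Bspan x.
rewrite !linear_sum big_seq [RHS]big_seq; apply: eq_bigr => v /sB vB.
by rewrite !linearZ hh'.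
Qed.

(** A nonempty finite part of the union already lies in one member of the chain. *)
Lemma lin_indep_chain E (C : set (set E)) :
    C `<=` @lin_indep K E -> total_on C subset ->
  lin_indep (\bigcup_(X in C) X).
Proof.
move=> Cfree Ctot s c us sC s0.
(* The empty sequence is kept apart because [C] may be empty. *)
have [->//|[X [CX sX]]] : s = [::] \/ exists X, C X /\ [set` s] `<=` X.
  elim: s sC {us s0} => [|x s IH] sC; first by left.
  right; have [Y CY Yx] := sC x (mem_head _ _).
  case: IH => [z zs|s0|[X [CX sX]]]; first by apply: sC; rewrite /= inE zs orbT.
    by exists Y; split=> // z /=; rewrite s0 inE => /eqP->.
  have [XY|YX] := Ctot _ _ CX CY.
    by exists Y; split=> // z /=; rewrite inE => /predU1P[->//|/sX/XY].
  by exists X; split=> // z /=; rewrite inE => /predU1P[->|/sX//]; exact: YX.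
exact: Cfree CX _ _ us sX s0.
Qed.

(** A dependence with nonzero coefficient at [x] could be solved for [x], placing it in the span of
    [B]. *)
Lemma lin_indep_setU1 E (B : set E) x : lin_indep B ->
    ~ (exists (s : seq E) (c : E -> K),
         [set` s] `<=` B /\ x = \sum_(v <- s) c v *: v) ->
  lin_indep (x |` B).
Proof.
move=> Bfree xB s c us sxB s0.
have [xs|xs] := boolP (x \in s); last first.
  apply: Bfree s0 => // v vs; case: (sxB v vs) => // vx.
  by rewrite -vx (vs : is_true (v \in s)) in xs.
have remB : [set` rem x s] `<=` B.
  move=> v /=; rewrite mem_rem_uniq// => /andP[/= vx vs].
  by case: (sxB v vs) => // /eqP; rewrite (negPf vx).
move: s0; rewrite (big_rem x)//=.
have [cx0|cx0] := eqVneq (c x) 0; last first.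
  move=> /eqP; rewrite addr_eq0 => /eqP cxE; case: xB.
  exists (rem x s), (fun v => - (c x)^-1 * c v); split=> //.
  under eq_bigr do rewrite -scalerA.
  by rewrite -scaler_sumr scaleNr -scalerN -cxE scalerA mulVf// scale1r.
rewrite cx0 scale0r add0r => /Bfree-/(_ (rem_uniq _ us) remB) c0 v vs.
by have [->//|vx] := eqVneq v x; apply: c0; rewrite mem_rem_uniq// inE vx.
Qed.

(** Zorn gives a maximal independent set; a vector outside its span could be adjoined. *)
Lemma basis_exists E : exists B : set E, basis B.
Proof.
have [B [Bfree Bmax]] := Zorn_bigcup (@lin_indep_chain E).
exists B; split=> // x; apply: contrapT => xB.
apply: (Bmax (x |` B)); last exact: lin_indep_setU1.
split=> [|sB]; first exact: subsetUr.
apply: xB; exists [:: x], (fun=> 1); split; last by rewrite big_seq1 scale1r.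
by move=> v /=; rewrite inE => /eqP->; apply: sB; left.
Qed.

(** Preimages chosen on a basis of [F] extend linearly. *)
Lemma surjective_section E F (p : {linear E -> F}) : (forall y, exists x, p x = y) ->
  exists s : {linear F -> E}, forall y, p (s y) = y.
Proof.
move=> psurj; have [g pg] := choice psurj; have [B Bbasis] := basis_exists F.
have [s sg] := linear_extension g Bbasis; exists s.
apply: (@eq_on_spanning _ _ B (p \o s) idfun) => [|b Bb /=]; first by case: Bbasis.
by rewrite sg.
Qed.

(** A bijection of bases and its inverse extend to mutually inverse linear maps; conversely, an
    isomorphism carries a basis to a basis. *)
Lemma eq_dimP E F : eq_dim E F <->
  exists (h : {linear E -> F}) (h' : {linear F -> E}), cancel h h' /\ cancel h' h.
Proof.
split=> [[A [B [Abasis Bbasis /card_bijP[g [g' gK g'K]]]]]|[h [h' [hK h'K]]]].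
  have ext (E1 E2 : lmodType K) (A1 : set E1) (A2 : set E2) (k : A1 -> A2) :
      basis A1 -> exists h : {linear E1 -> E2}, forall b : A1, h (val b) = val (k b).
    move=> A1basis.
    (* The value 0 outside [A1] only makes [k'] total. *)
    pose k' b := if pselect (A1 b) is left Ab then val (k (SigSub (mem_set Ab))) else 0.
    have [h hk'] := linear_extension k' A1basis; exists h => b.
    have A1b : A1 (val b) by case: b => b /= /set_mem.
    rewrite hk'// /k'; case: pselect => // Ab.
    by congr (val (k _)); apply: val_inj.
  have [h hg] := ext _ _ _ _ g Abasis; have [h' hg'] := ext _ _ _ _ g' Bbasis.
  exists h, h'; split.
    apply: (@eq_on_spanning _ _ A (h' \o h) idfun) => [|b Ab /=].
      by case: Abasis.
    by have := congr1 h' (hg (SigSub (mem_set Ab))); rewrite hg' gK.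
  apply: (@eq_on_spanning _ _ B (h \o h') idfun) => [|b Bb /=].
    by case: Bbasis.
  by have := congr1 h (hg' (SigSub (mem_set Bb))); rewrite hg g'K.
have [A [Afree Aspan]] := basis_exists E.
exists A, (h @` A); split=> //; first split.
- move=> s c us sA s0 v vs.
  have := Afree [seq h' v | v <- s] (c \o h).
  rewrite map_inj_uniq ?big_map; last exact: can_inj h'K.
  move=> /(_ us) Aindep; rewrite -[v]h'K; apply: Aindep; last exact: map_f.
    move=> _ /mapP[w ws ->].
    by have [x Ax <-] := sA w ws; rewrite hK.
  rewrite -[RHS](linear0 h') -s0 linear_sum; apply: eq_bigr => w _.
  by rewrite linearZ /= h'K.
- move=> y; have [s [c [sA yE]]] := Aspan (h' y).
  exists [seq h v | v <- s], (c \o h'); split.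
    by move=> _ /mapP[v /sA Av ->]; exists v.
  rewrite big_map -[y]h'K yE linear_sum; apply: eq_bigr => v _.
  by rewrite linearZ /= hK.
- by rewrite card_eq_sym; apply: inj_card_eq => x y _ _; exact: can_inj hK _ _.
Qed.

(** Two surjections with the same null space factor through each other, and the two factors are
    mutually inverse. *)
Lemma linear_lift E F Z (p : {linear Z -> E}) (q : {linear Z -> F}) :
    (forall x, exists z, p z = x) -> (forall y, exists z, q z = y) ->
    (forall z, p z = 0 <-> q z = 0) ->
  exists (u : {linear E -> F}) (v : {linear F -> E}),
    [/\ cancel u v, cancel v u & forall z, u (p z) = q z].
Proof.
move=> psurj qsurj pq0.
have [z /pq0//|u up] := linear_factor psurj (q := q).
have [z /pq0//|v vq] := linear_factor qsurj (q := p).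
exists u, v; split=> // x.
  by have [z <-] := psurj x; rewrite up vq.
by have [z <-] := qsurj x; rewrite vq up.
Qed.

End LinearExtension.

(** * Quotient maps, projectors and extension of partial isomorphisms *)

Section Complements.
Variables (K : fieldType) (V : lmodType K).
Implicit Types U W : submodClosed V.

Lemma submodN U x : (- x \in U) = (x \in U).
Proof. exact: (rpredN (submod_pred U)). Qed.

Lemma submodB U x y : x \in U -> y \in U -> x - y \in U.
Proof. exact: (@rpredB _ (submod_pred U)). Qed.

Lemma quot_proj_exists U : exists p : {linear V -> quotsp U},
  (forall y, exists x, p x = y) /\ (forall x, p x = 0 <-> x \in U).
Proof.
have pi_lin : linear (\pi_(quotsp U)%qT : V -> quotsp U).
  move=> a x y; rewrite (@raddfD _ (Quotient.quot (submod_pred U))).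
  by congr (_ + _); exact: esym (pi_scale U a x).
pose p : {linear V -> quotsp U} :=
  HB.pack (\pi_(quotsp U)%qT : V -> quotsp U)
    (GRing.isLinear.Build K V (quotsp U) *:%R _ pi_lin).
exists p; split=> [y|x]; first by exists (repr y); exact: reprK.
rewrite -(linear0 p); split=> [/(pi_eqP U x 0)|xU]; first by rewrite subr0.
by apply/(pi_eqP U x 0); rewrite subr0.
Qed.

(** Subtracting from each vector the chosen lift of its class modulo [U] leaves an element of
    [U]. *)
Lemma projector_exists U : exists p : {linear V -> V},
  (forall x, p x \in U) /\ {in U, forall x, p x = x}.
Proof.
have [q [qsurj q0]] := quot_proj_exists U.
have [s qs] := surjective_section qsurj.
exists (idfun \- (s \o q)); split=> x /=.
  by apply/q0; rewrite linearB qs subrr.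
by move=> /q0->; rewrite linear0 subr0.
Qed.

Section Intersection.
Variables U W : submodClosed V.

Definition cap_pred : {pred V} := [predI U & W].

Lemma cap_pred_closed : submod_closed cap_pred.
Proof.
split=> [|a x y]; first by rewrite inE /= !rpred0.
by move=> /andP[xU xW] /andP[yU yW]; rewrite inE /= !rpredD ?rpredZ.
Qed.

HB.instance Definition _ :=
  GRing.isSubmodClosed.Build K V cap_pred cap_pred_closed.

Definition capsp : submodClosed V := cap_pred.

End Intersection.

(** The composite of [u] with the projection modulo [W] is onto with null space [U], so it induces
    an isomorphism of the quotients. *)
Lemma eq_codim_iso U W (u v : {linear V -> V}) : cancel u v -> cancel v u ->
  (forall x, (u x \in W) = (x \in U)) -> eq_codim U W.
Proof.
move=> uK vK uUW.
have [p [psurj p0]] := quot_proj_exists U.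
have [q [qsurj q0]] := quot_proj_exists W.
have [|z|h [h' [hK h'K _]]] := linear_lift psurj (q := q \o u).
- by move=> y; have [x <-] := qsurj y; exists (v x); rewrite /= vK.
- by split=> [/p0 zU|/q0]; [apply/q0; rewrite uUW|rewrite uUW => /p0].
by apply/eq_dimP; exists h, h'.
Qed.

(* A partial isomorphism [p z |-> q z] from [U] onto [W] extends to [V] by an
   isomorphism between complements of [U] and [W]. *)
Lemma automorphism_extension (Z : lmodType K) U W (p q : {linear Z -> V}) :
    eq_codim U W ->
    (forall x, x \in U <-> exists z, p z = x) ->
    (forall x, x \in W <-> exists z, q z = x) ->
    (forall z, p z = 0 <-> q z = 0) ->
  exists u v : {linear V -> V}, [/\ cancel u v, cancel v u & forall z, u (p z) = q z].
Proof.
move=> /eq_dimP[h [h' [hK h'K]]] pU qW pq0.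
have [a [asurj a0]] := quot_proj_exists U.
have [b [bsurj b0]] := quot_proj_exists W.
have [s as_] := surjective_section asurj.
have [t bt] := surjective_section bsurj.
have ap z : a (p z) = 0 by apply/a0/pU; exists z.
have bq z : b (q z) = 0 by apply/b0/qW; exists z.
(* The sections [s] and [t] embed complements of [U] and [W], matched by [h]; thus [P] and [Q] both
   map onto [V], with equal null spaces. *)
pose P : {linear (Z * quotsp U)%type -> V} := (p \o fst) \+ (s \o snd).
pose Q : {linear (Z * quotsp U)%type -> V} := (q \o fst) \+ (t \o h \o snd).
have [x|x|[z c]|u [v [uK vK uP]]] := linear_lift (p := P) (q := Q).
- have [|z pz] := (pU (x - s (a x))).1.
    by apply/a0; rewrite linearB as_ subrr.
  by exists (z, a x); rewrite /P /= pz subrK.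
- have [|z qz] := (qW (x - t (b x))).1.
    by apply/b0; rewrite linearB bt subrr.
  by exists (z, h' (b x)); rewrite /Q /= h'K qz subrK.
- rewrite /P /Q /=; split=> e.
    have c0 : c = 0 by rewrite -(linear0 a) -e linearD ap as_ add0r.
    move: e; rewrite c0 !linear0 !addr0; exact: (pq0 z).1.
  have c0 : c = 0.
    by apply: (can_inj hK); rewrite linear0 -(linear0 b) -e linearD bq bt add0r.
  move: e; rewrite c0 !linear0 !addr0; exact: (pq0 z).2.
exists u, v; split=> // z.
by have := uP (z, 0); rewrite /P /Q /= !linear0 !addr0.
Qed.

End Complements.

(** * Restriction to [W] and the characterization of unit-regularity *)

Lemma L_app (K : fieldType) (U : lmodType K) (f g : L U) : f = g -> f =1 g.
Proof. by move->. Qed.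

Section Restriction.
Variables (K : fieldType) (V : lmodType K) (W : submodClosed V).
Variable S : mulgClosed (L (subsp W)).

(** The restriction does not depend on the chosen proof of stability. *)
Lemma restr_in (f : L V) (fW : stable W f) : (restr fW \in S) = (f \in L_S S).
Proof.
apply/idP/idP => [fS|/asboolP[fW' fS]]; first by apply/asboolP; exists fW.
by rewrite (_ : restr fW = restr fW')//; apply: L_eq => w; apply: val_inj.
Qed.

Lemma restr_unit (f : L V) (fW : stable W f) :
  is_unit_of (L_S S) f -> is_unit_of S (restr fW).
Proof.
move=> [fS [g gS [fg gf]]]; split; first by rewrite restr_in.
have gW := L_S_stable gS; exists (restr gW); first by rewrite restr_in.
split; apply: L_eq => w; apply: val_inj; first exact: L_app fg _.
exact: L_app gf _.
Qed.

End Restriction.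

Local Notation in_sub yW := (exist (fun y => is_true (y \in _)) _ yW : subsp _).

Theorem theorem4p6 (K : fieldType) (V : lmodType K) (W : submodClosed V)
    (S : mulgClosed (L (subsp W))) (S1 : 1%g \in S)
    (f : L V) (fS : f \in L_S S) :
  let fW : L (subsp W) := restr (L_S_stable fS) in
  unit_regular (L_S S) f <->
  [/\ unit_regular S fW,
      range f `&` [set` W] = [set val w | w in range fW] &
      exists T : submodClosed V,
        [/\ transversal_of (kernel_rel f) [set` T],
            transversal_of (kernel_rel fW) [set w | val w \in T] &
            eq_codim (sumsp W T) (sumsp W (rangesp f))]].
Proof.
move=> fW; have fstab := L_S_stable fS; split.
- move=> [_ [u uU fuf_eq]]; have [uS [v vS [uv vu]]] := uU.
  have fuf x : f (u (f x)) = f x by exact: L_app fuf_eq x.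
  have uK : cancel u v by exact: L_app uv.
  have vK : cancel v u by exact: L_app vu.
  have uW := L_S_stable uS; have vW := L_S_stable vS.
  split.
  + split; first by rewrite restr_in.
    exists (restr uW); first exact: restr_unit.
    by apply: L_eq => w; apply: val_inj; exact: fuf.
  (* If [f x] lies in [W], so does [u (f x)], and [f] sends it back to [f x]. *)
  + apply/seteqP; split=> [_ [[x _ <-] /= fxW]|_ [_ [w _ <-] <-]] /=.
      exists (fW (in_sub (uW _ fxW))); last exact: fuf.
      by exists (in_sub (uW _ fxW)).
    by split; [exists (val w)|exact: fstab (valP w)].
  + exists (rangesp (f * u)%g); split.
    * move=> x; exists (u (f x)); split=> [|t [/asboolP[y _ <-]]].
        split; last by rewrite /kernel_rel /= fuf.
        by apply/asboolP; exists x.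
      by rewrite /kernel_rel /= => ->; rewrite fuf.
    * move=> x; exists (restr uW (fW x)); split=> [|t [/asboolP[y _ yt]]].
        split; last by apply: val_inj; rewrite /= fuf.
        by apply/asboolP; exists (val x).
      move=> /(congr1 val) /= e; apply: val_inj => /=.
      by rewrite e -yt /= fuf.
    (* The inverse [v] maps [W] onto itself and the range of [f * u] onto that of [f]. *)
    * apply: (eq_codim_iso vK uK) => x.
      apply/asboolP/asboolP => [[w [y [wW /asboolP[z _ yz] e]]]|].
        exists (u w), (u y); split; [exact: uW| |by rewrite -linearD -e vK].
        by apply/asboolP; exists z; rewrite //= yz.
      move=> [w [y [wW /asboolP[z _ yz] ->]]].
      exists (v w), (f z); split; [exact: vW| |by rewrite linearD -yz /= uK].
      by apply/asboolP; exists z.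
- move=> [[_ [u0 u0U fuf0_eq]] rangeW [T [Ttrans TWtrans codimTR]]].
  have [u0S [v0 v0S [uv0 vu0]]] := u0U.
  have fuf0 w : fW (u0 (fW w)) = fW w by exact: L_app fuf0_eq w.
  have u0K : cancel u0 v0 by exact: L_app uv0.
  have v0K : cancel v0 u0 by exact: L_app vu0.
  have Tinj t t' : t \in T -> t' \in T -> f t = f t' -> t = t'.
    move=> tT t'T ftt'; have [r [_ runiq]] := Ttrans t.
    by rewrite -(runiq t) ?(runiq t').
  (* By (ii), [f t] is also the image of some [w] in [W]; the representative of [w] in both [W] and
     [T] has the same image as [t], hence equals [t]. *)
  have TW t : t \in T -> f t \in W -> t \in W.
    move=> tT ftW.
    have [_ [w _ <-] /= fwt] : [set val w | w in range fW] (f t).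
      by rewrite -rangeW; split=> //; exists t.
    have [t' [[/= t'T /(congr1 val) /= ft'] _]] := TWtrans w.
    by rewrite (Tinj t (val t')) -?fwt ?ft' ?(valP t').
  have [q [qT qid]] := projector_exists T.
  have [p [pWT pid]] := projector_exists (capsp W T).
  have {}pWT x : p x \in W /\ p x \in T by apply/andP; exact: pWT.
  have {}pid x : x \in W -> x \in T -> p x = x.
    by move=> xW xT; apply: pid; apply/andP.
  (* [k] maps onto a complement of [capsp W T] in [T], so [W + T] is the direct sum
     of [W] and the range of [k], and [W + R(f)] that of [W] and [f (range k)]. *)
  have [k [kT kW kE]] : exists k : {linear V -> V}, [/\ forall x, k x \in T,
      forall x, k x \in W -> k x = 0 & forall t, t \in T -> t = p t + k t].
    have kT x : q x - p (q x) \in T by rewrite submodB//; case: (pWT (q x)).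
    exists (q \- (p \o q)); split=> [x|x /= kxW|t tT /=]; first exact: kT.
      have [pW pT] := pWT (q x).
      by rewrite -(pid _ kxW (kT x)) linearB (pid _ pW pT) subrr.
    by rewrite qid// subrKC.
  (* Both sums are parametrized by the same space: [a] covers [W + R(f)] and [b] covers [W + T].
     Placing [u0] in [b] forces a map taking [a z] to [b z] to agree with [u0] on [W]. *)
  pose a : {linear (subsp W * V)%type -> V} := (val \o fst) \+ (f \o k \o snd).
  pose b : {linear (subsp W * V)%type -> V} := (val \o u0 \o fst) \+ (k \o snd).
  (* The equality of codimensions goes from [W + T] to [W + R(f)], so the extension obtained is [v];
     the required unit is its inverse [u]. *)
  have [x|x|[w x]|v [u [vK uK vba]]] :=
      automorphism_extension (p := b) (q := a) codimTR.
  + split=> [/asboolP[w [t [wW tT ->]]]|[[w y] <-]]; last first.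
      by apply/asboolP; exists (val (u0 w)), (k y); split=> //; exact: valP.
    have [pW _] := pWT t.
    (* The part [p t] of [t] is absorbed into [W], and [v0] cancels the [u0] in [b]. *)
    exists (v0 (in_sub wW + in_sub pW), t).
    by rewrite /b /= v0K /= -addrA -kE.
  + split=> [/asboolP[w [y [wW /asboolP[z _ <-] ->]]]|[[w y] <-]]; last first.
      apply/asboolP; exists (val w), (f (k y)); split=> //; first exact: valP.
      by apply/asboolP; exists (k y).
    (* Replacing [z] by its representative [t] splits [f z] into [f (p t)], which lies in [W], and
       [f (k t)]. *)
    have [t [[tT /= ft] _]] := Ttrans z; rewrite /kernel_rel /= in ft.
    have [pW _] := pWT t; pose w' := in_sub (fstab _ pW).
    exists (in_sub wW + w', t); rewrite /a /= -addrA; congr (_ + _).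
    by rewrite ft -linearD -kE.
  (* A zero of [b] puts [k x] in [W]; a zero of [a] puts [f (k x)] in [W], and then [k x] too by
     [TW]. Either way [k x = 0]. *)
  + rewrite /a /b /=; split=> /eqP; rewrite addr_eq0 => /eqP e.
      have kx0 : k x = 0.
        by apply/kW; rewrite -[k _]opprK -e submodN; exact: valP.
      move: e; rewrite kx0 !linear0 => w0.
      have -> : w = 0 by apply: (can_inj u0K); rewrite linear0; apply: val_inj.
      by rewrite addr0.
    have kx0 : k x = 0.
      apply/kW/TW => //; rewrite -[f _]opprK -e submodN; exact: valP.
    move: e; rewrite kx0 !linear0 => w0.
    by rewrite (_ : w = 0) ?linear0 ?addr0//; apply: val_inj.
  have uab z : u (a z) = b z by rewrite -vba vK.
  have uw w : u (val w) = val (u0 w).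
    by have := uab (w, 0); rewrite /a /b /= !linear0 !addr0.
  have ufk x : u (f (k x)) = k x.
    by have := uab (0, x); rewrite /a /b /= !linear0 !add0r.
  have vw w : v (val w) = val (v0 w) by rewrite -[w in LHS]v0K -uw uK.
  have uW : stable W u by move=> w wW; rewrite (uw (in_sub wW)); exact: valP.
  have vW : stable W v by move=> w wW; rewrite (vw (in_sub wW)); exact: valP.
  have uu0 : restr uW = u0 by apply: L_eq => w; apply: val_inj; exact: uw.
  have vv0 : restr vW = v0 by apply: L_eq => w; apply: val_inj; exact: vw.
  split=> //; exists u.
    split; first by rewrite -(restr_in S uW) uu0.
    exists v; first by rewrite -(restr_in S vW) vv0.
    by split; apply: L_eq.
  apply: L_eq => x /=.
  (* It suffices to treat the representative [t]: on [p t] the identity comes from [u0], and on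
     [k t] from [u] inverting [f]. *)
  have [t [[tT ft] _]] := Ttrans x; rewrite /kernel_rel /= in ft.
  have [pW _] := pWT t.
  have fup : f (u (f (p t))) = f (p t).
    have := congr1 val (fuf0 (in_sub pW)).
    by rewrite /= -uw.
  suff : f (u (f t)) = f t by rewrite -ft.
  by rewrite (kE t tT) !linearD /= fup ufk.
Qed.
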